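(* Let $B$ be a Rota-Baxter operator on a commutative Hopf heap $(C,\Delta,[-,-,-])$ such that $B$ is surjective and $\varepsilon\circ B=\varepsilon$. Define $$\Delta'(a)=[a_1,B(a_4),B(a_2)]\otimes a_3\qquad(a\in C).$$ Then $C_B=(C,\Delta',[-,-,-])$, where $(C,\Delta',\varepsilon)$ is the underlying coalgebra, is a Hopf heap.
   Context: Everything is over a fixed field $\mathbf{k}$. Sweedler notation $\Delta(c)=c_1\otimes c_2$ (iterated: $c_1\otimes c_2\otimes c_3\otimes c_4$) is used; $C^{cop}$ is the co-opposite coalgebra. All Hopf heaps are assumed to have at least one group-like element. A Hopf heap is a coalgebra $C$ with a coalgebra map $C\otimes C^{cop}\otimes C\to C$, $a\otimes b\otimes c\mapsto[a,b,c]$, such that $[[a,b,c],d,h]=[a,b,[c,d,h]]$ and $[c_1,c_2,a]=[a,c_1,c_2]=\varepsilon(c)a$ for all $a,b,c,d,h\in C$. It is commutative if $[x,y,z]=[z,y,x]$ for all $x,y,z$. A Rota-Baxter operator on a Hopf heap $C$ is a linear map $B:C\to C$ with $B([a,b,c])=[B(a),B(b),B(c)]$ and $B(a_1)\otimes B(a_2)=[B(a)_1,B(B(a)_4),B(B(a)_2)]\otimes B(a)_3$ for all $a,b,c\in C$. *)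

(* Defs.v *)
From HB Require Import structures.
From mathcomp Require Import all_boot all_order all_algebra.
From mathcomp Require Import boolp.

Set Implicit Arguments.
Unset Strict Implicit.
Unset Printing Implicit Defensive.
Import GRing.Theory.
Local Open Scope ring_scope.
Local Open Scope quotient_scope.

Definition bilinear (k : fieldType) (V W U : lmodType k) (f : V -> W -> U) :=
  (forall w, linear (f^~ w)) /\ (forall v, linear (f v)).

(* The tensor product of two vector spaces: the formal sum v1 (x) w1 + ... +
   vn (x) wn is represented by the sequence of the pairs (vi, wi), and formal
   sums are identified along the least congruence that makes (x) bilinear and
   + commutative.  The universal property is [tlift_tens], [tlift_linear] and
   [tensor_ext] below. *)
Section TensorType.
Variables (k : fieldType) (V W : lmodType k).

Inductive tensor_eq : seq (V * W) -> seq (V * W) -> Prop :=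
| teq_refl s : tensor_eq s s
| teq_sym s t : tensor_eq s t -> tensor_eq t s
| teq_trans s t u : tensor_eq s t -> tensor_eq t u -> tensor_eq s u
| teq_cat s s' t t' :
    tensor_eq s s' -> tensor_eq t t' -> tensor_eq (s ++ t) (s' ++ t')
| teq_comm s t : tensor_eq (s ++ t) (t ++ s)
| teq_0 w : tensor_eq [:: (0, w)] [::]
| teq_addl v v' w : tensor_eq [:: (v + v', w)] [:: (v, w); (v', w)]
| teq_addr v w w' : tensor_eq [:: (v, w + w')] [:: (v, w); (v, w')]
| teq_scale a v w : tensor_eq [:: (a *: v, w)] [:: (v, a *: w)].

Definition tensor_eqb (s t : seq (V * W)) : bool := `[< tensor_eq s t >].

Lemma tensor_eqb_equiv : equiv_class_of tensor_eqb.
Proof.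
split=> [s|s t|t s u].
- by apply/asboolP; exact: teq_refl.
- by apply/idP/idP => /asboolP st; apply/asboolP; exact: teq_sym.
- by move=> /asboolP st /asboolP tu; apply/asboolP; exact: teq_trans tu.
Qed.

Canonical tensor_eqb_equiv_rel := EquivRelPack tensor_eqb_equiv.

Definition tensor := {eq_quot tensor_eqb}.
HB.instance Definition _ := Choice.on tensor.
HB.instance Definition _ := EqQuotient.on tensor.

Lemma tensor_eqP (s t : seq (V * W)) :
  tensor_eq s t <-> \pi_tensor s = \pi_tensor t.
Proof. by split=> [st|/eqquotP/asboolP//]; apply/eqquotP/asboolP. Qed.

Lemma tensor_repr (s : seq (V * W)) : tensor_eq (repr (\pi_tensor s)) s.
Proof. by apply/tensor_eqP; rewrite reprK. Qed.

Definition tens (v : V) (w : W) : tensor := \pi_tensor [:: (v, w)].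
Definition tscale_seq (a : k) (s : seq (V * W)) := [seq (a *: p.1, p.2) | p <- s].

Definition tzero : tensor := \pi_tensor [::].
Definition tadd (x y : tensor) : tensor := \pi_tensor (repr x ++ repr y).
Definition tscale (a : k) (x : tensor) : tensor :=
  \pi_tensor (tscale_seq a (repr x)).
Definition topp : tensor -> tensor := tscale (-1).

Lemma tscale_seq_eq a s t :
  tensor_eq s t -> tensor_eq (tscale_seq a s) (tscale_seq a t).
Proof.
elim=> {s t} /=.
- by move=> s; exact: teq_refl.
- by move=> s t _; exact: teq_sym.
- by move=> s t u _ + _; exact: teq_trans.
- by move=> s s' t t' _ ss' _ tt'; rewrite /tscale_seq !map_cat; exact: teq_cat.
- by move=> s t; rewrite /tscale_seq !map_cat; exact: teq_comm.
- by move=> w; rewrite scaler0; exact: teq_0.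
- by move=> v v' w; rewrite scalerDr; exact: teq_addl.
- by move=> v w w'; exact: teq_addr.
- by move=> b v w; rewrite scalerA mulrC -scalerA; exact: teq_scale.
Qed.

Lemma tadd_pi s t : tadd (\pi_tensor s) (\pi_tensor t) = \pi_tensor (s ++ t).
Proof. by apply/tensor_eqP; apply: teq_cat; exact: tensor_repr. Qed.

Lemma tscale_pi a s : tscale a (\pi_tensor s) = \pi_tensor (tscale_seq a s).
Proof. by apply/tensor_eqP; apply: tscale_seq_eq; exact: tensor_repr. Qed.

Lemma tensorP (x : tensor) : exists s, x = \pi_tensor s.
Proof. by exists (repr x); rewrite reprK. Qed.

Lemma taddA : associative tadd.
Proof.
move=> x y z; have [s ->] := tensorP x; have [t ->] := tensorP y.
have [u ->] := tensorP z.
by rewrite (tadd_pi t u) (tadd_pi s t) (tadd_pi s) (tadd_pi (s ++ t)) catA.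
Qed.

Lemma taddC : commutative tadd.
Proof. by move=> x y; apply/tensor_eqP; exact: teq_comm. Qed.

Lemma tadd0 : left_id tzero tadd.
Proof. by move=> x; have [s ->] := tensorP x; rewrite [LHS]tadd_pi. Qed.

Lemma tscaleDr a : {morph tscale a : x y / tadd x y}.
Proof.
move=> x y; have [s ->] := tensorP x; have [t ->] := tensorP y.
rewrite (tadd_pi s t) !(tscale_pi a (_ ++ _), tscale_pi a s, tscale_pi a t).
by rewrite [RHS]tadd_pi /tscale_seq map_cat.
Qed.

Lemma tscaleDl x : {morph tscale^~ x : a b / a + b >-> tadd a b}.
Proof.
move=> a b /=; have [s ->] := tensorP x.
elim: s => [|[v w] s IHs].
  by rewrite (tscale_pi a) (tscale_pi b) tscale_pi [RHS]tadd_pi.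
have -> : \pi_tensor ((v, w) :: s) = tadd (tens v w) (\pi_tensor s).
  by rewrite [RHS]tadd_pi.
have tE : tscale (a + b) (tens v w) =
    tadd (tscale a (tens v w)) (tscale b (tens v w)).
  rewrite (tscale_pi a) (tscale_pi b) tscale_pi [RHS]tadd_pi /= scalerDl.
  by apply/tensor_eqP; exact: teq_addl.
rewrite 3!tscaleDr IHs tE -!taddA; congr (tadd _ _).
by rewrite !taddA; congr (tadd _ _); rewrite taddC.
Qed.

Lemma tscale0 x : tscale 0 x = tzero.
Proof.
have [s ->] := tensorP x; rewrite [LHS]tscale_pi; apply/tensor_eqP.
elim: s => [|[v w] s IHs] /=; first exact: teq_refl.
rewrite scale0r; apply: (@teq_cat [:: (0, w)] [::] _ [::] _ IHs).
exact: teq_0.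
Qed.

Lemma tscale1 : left_id 1 tscale.
Proof.
move=> x; have [s ->] := tensorP x; rewrite [LHS]tscale_pi /tscale_seq.
by rewrite (@eq_map _ _ _ id) ?map_id// => -[v w]; rewrite /= scale1r.
Qed.

Lemma tscaleA a b x : tscale a (tscale b x) = tscale (a * b) x.
Proof.
have [s ->] := tensorP x.
rewrite (tscale_pi b s) (tscale_pi a) tscale_pi /tscale_seq -map_comp.
by congr (\pi_tensor _); apply: eq_map => -[v w]; rewrite /= scalerA.
Qed.

Lemma taddN : left_inverse tzero topp tadd.
Proof.
move=> x; rewrite -{2}[x]tscale1 /topp -tscaleDl.
by rewrite addNr tscale0.
Qed.

HB.instance Definition _ := GRing.isZmodule.Build tensor taddA taddC tadd0 taddN.

HB.instance Definition _ :=
  GRing.Zmodule_isLmodule.Build k tensor tscaleA tscale1 tscaleDr tscaleDl.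

Lemma tens_bilinear : bilinear tens.
Proof.
split=> [w a v v'|v a w w'].
  transitivity (tens (a *: v) w + tens v' w).
    by rewrite [RHS]tadd_pi; apply/tensor_eqP; exact: teq_addl.
  by congr (_ + _); rewrite [RHS]tscale_pi.
transitivity (tens v (a *: w) + tens v w').
  by rewrite [RHS]tadd_pi; apply/tensor_eqP; exact: teq_addr.
congr (_ + _); rewrite [RHS]tscale_pi.
by apply/tensor_eqP; apply: teq_sym; exact: teq_scale.
Qed.

(* For bilinear f, the linear map that sends v (x) w to f v w; its values are
   meaningless when f is not bilinear. *)
Definition tlift (U : lmodType k) (f : V -> W -> U) (x : tensor) : U :=
  \sum_(p <- repr x) f p.1 p.2.

Section Lift.
Variables (U : lmodType k) (f : V -> W -> U).
Hypothesis f_bilinear : bilinear f.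

Let f_scalel a v w : f (a *: v) w = a *: f v w.
Proof.
have [fl _] := f_bilinear.
have f0 : f 0 w = 0.
  have := fl w (-1) 0 0; rewrite scaler0 addr0 => {1}->.
  by rewrite scaleN1r addNr.
by have := fl w a v 0; rewrite !addr0 f0 addr0.
Qed.

Let f_scaler a v w : f v (a *: w) = a *: f v w.
Proof.
have [_ fr] := f_bilinear.
have f0 : f v 0 = 0.
  have := fr v (-1) 0 0; rewrite scaler0 addr0 => {1}->.
  by rewrite scaleN1r addNr.
by have := fr v a w 0; rewrite !addr0 f0 addr0.
Qed.

Lemma tlift_pi s : tlift f (\pi_tensor s) = \sum_(p <- s) f p.1 p.2.
Proof.
have [fl fr] := f_bilinear.
suff tlift_eq s' t : tensor_eq s' t ->
    \sum_(p <- s') f p.1 p.2 = \sum_(p <- t) f p.1 p.2.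
  exact/tlift_eq/tensor_repr.
elim=> {s s' t} //=.
- by move=> s t u _ -> _ ->.
- by move=> s s' t t' _ ss' _ tt'; rewrite !big_cat ss' tt'.
- by move=> s t; rewrite !big_cat /= addrC.
- by move=> w; rewrite big_seq1 big_nil /= -{1}(scale0r (0 : V)) f_scalel scale0r.
- move=> v v' w; rewrite big_seq1 big_cons big_seq1 /=.
  by have := fl w 1 v v'; rewrite !scale1r.
- move=> v w w'; rewrite big_seq1 big_cons big_seq1 /=.
  by have := fr v 1 w w'; rewrite !scale1r.
- by move=> a v w; rewrite !big_seq1 /= f_scalel f_scaler.
Qed.

Lemma tlift_tens v w : tlift f (tens v w) = f v w.
Proof. by rewrite tlift_pi big_seq1. Qed.

Lemma tlift_linear : linear (tlift f).
Proof.
move=> a x y; have [s ->] := tensorP x; have [t ->] := tensorP y.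
rewrite [a *: _]tscale_pi [_ + _]tadd_pi !tlift_pi big_cat big_map scaler_sumr.
by congr (_ + _); apply: eq_bigr => p _; rewrite /= f_scalel.
Qed.

End Lift.

Lemma tlift_linearf (U : lmodType k) a (f g h : V -> W -> U) x :
  (forall v w, f v w = a *: g v w + h v w) ->
  tlift f x = a *: tlift g x + tlift h x.
Proof.
by move=> fE; rewrite scaler_sumr -big_split; apply: eq_bigr => p _; exact: fE.
Qed.

Lemma tensor_sum (x : tensor) : exists s : seq (V * W),
  x = \sum_(p <- s) tens p.1 p.2.
Proof.
have [s ->] := tensorP x; exists s.
elim: s => [|[v w] s IHs]; first by rewrite big_nil.
by rewrite big_cons -IHs [RHS]tadd_pi.
Qed.

Lemma tensor_ext (U : lmodType k) (f g : {linear tensor -> U}) :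
  (forall v w, f (tens v w) = g (tens v w)) -> f =1 g.
Proof.
move=> fg x; have [s ->] := tensor_sum x.
by rewrite !linear_sum; apply: eq_bigr => p _; exact: fg.
Qed.

End TensorType.

Notation "V ⊗ W" := (tensor V%type W%type) (at level 40, left associativity) : type_scope.
Notation "v ⊗ w" := (tens v w) (at level 40, left associativity) : ring_scope.

(* Sweedler notation: for a multilinear expression E, the value at t of the
   linear map that sends x1 (x) x2, resp. ((x1 (x) x2) (x) x3) (x) x4, to E. *)
Definition tlift4 (k : fieldType) (V1 V2 V3 V4 U : lmodType k)
    (f : V1 -> V2 -> V3 -> V4 -> U) (t : V1 ⊗ V2 ⊗ V3 ⊗ V4) : U :=
  tlift (fun x x4 => tlift (fun y x3 =>
    tlift (fun x1 x2 => f x1 x2 x3 x4) y) x) t.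

Definition quadrilinear (k : fieldType) (V1 V2 V3 V4 U : lmodType k)
    (f : V1 -> V2 -> V3 -> V4 -> U) :=
  [/\ forall x2 x3 x4, linear (fun x1 => f x1 x2 x3 x4),
      forall x1 x3 x4, linear (fun x2 => f x1 x2 x3 x4),
      forall x1 x2 x4, linear (fun x3 => f x1 x2 x3 x4) &
      forall x1 x2 x3, linear (fun x4 => f x1 x2 x3 x4)].

Section Lift4.
Variables (k : fieldType) (V1 V2 V3 V4 U : lmodType k).
Variable f : V1 -> V2 -> V3 -> V4 -> U.
Hypothesis f_quadrilinear : quadrilinear f.

Let bilinear12 x3 x4 : bilinear (fun x1 x2 => f x1 x2 x3 x4).
Proof. by have [f1 f2 _ _] := f_quadrilinear; split. Qed.

Let bilinear3 x4 :
  bilinear (fun y x3 => tlift (fun x1 x2 => f x1 x2 x3 x4) y).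
Proof.
have [_ _ f3 _] := f_quadrilinear.
split=> [x3|y a x3 x3']; first exact: tlift_linear.
by apply: tlift_linearf => x1 x2; exact: f3.
Qed.

Let bilinear4 : bilinear (fun x x4 =>
  tlift (fun y x3 => tlift (fun x1 x2 => f x1 x2 x3 x4) y) x).
Proof.
have [_ _ _ f4] := f_quadrilinear.
split=> [x4|x a x4 x4']; first exact: tlift_linear.
apply: tlift_linearf => y x3; apply: tlift_linearf => x1 x2; exact: f4.
Qed.

Lemma tlift4_linear : linear (tlift4 f).
Proof. exact: tlift_linear. Qed.

Lemma tlift4_tens x1 x2 x3 x4 :
  tlift4 f (tens (tens (tens x1 x2) x3) x4) = f x1 x2 x3 x4.
Proof. by rewrite /tlift4 !tlift_tens. Qed.

End Lift4.

Notation "'\sw_' ( x1 , x2 <- t ) E" := (tlift (fun x1 x2 => E) t)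
  (at level 36, x1 name, x2 name, t at level 200, E at level 36,
   format "'\sw_' ( x1 ,  x2  <-  t )  E") : ring_scope.
Notation "'\sw_' ( x1 , x2 , x3 , x4 <- t ) E" :=
  (tlift4 (fun x1 x2 x3 x4 => E) t)
  (at level 36, x1 name, x2 name, x3 name, x4 name, t at level 200,
   E at level 36,
   format "'\sw_' ( x1 ,  x2 ,  x3 ,  x4  <-  t )  E") : ring_scope.

Section TensorMaps.
Variable k : fieldType.
Implicit Types V W : lmodType k.

Definition tmap V V' W W' (f : V -> V') (g : W -> W') (t : V ⊗ W) : V' ⊗ W' :=
  \sw_(v, w <- t) (f v ⊗ g w).

Lemma tmap_linear V V' W W' (f : {linear V -> V'}) (g : {linear W -> W'}) :
  linear (tmap f g).
Proof.
apply: tlift_linear; split=> [w|v] a x y; rewrite linearP.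
  by have [tl _] := tens_bilinear V' W'; exact: tl.
by have [_ tr] := tens_bilinear V' W'; exact: tr.
Qed.

HB.instance Definition _ V V' W W' (f : {linear V -> V'})
    (g : {linear W -> W'}) :=
  GRing.isLinear.Build k (V ⊗ W)%type (V' ⊗ W')%type *:%R (tmap f g)
    (tmap_linear f g).

Definition tswap V W (t : V ⊗ W) : W ⊗ V := \sw_(v, w <- t) (w ⊗ v).

Definition tassoc V1 V2 V3 (t : V1 ⊗ V2 ⊗ V3) : V1 ⊗ (V2 ⊗ V3) :=
  tlift (fun x v3 => \sw_(v1, v2 <- x) (v1 ⊗ (v2 ⊗ v3))) t.

End TensorMaps.

Section Coalgebra.
Variable k : fieldType.
Implicit Types C D : lmodType k.

Definition is_coalgebra C (Delta : C -> C ⊗ C) (eps : C -> k^o) : Prop :=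
  [/\ forall c, tassoc (tmap Delta idfun (Delta c)) = tmap idfun Delta (Delta c),
      forall c, \sw_(c1, c2 <- Delta c) (eps c1 *: c2) = c &
      forall c, \sw_(c1, c2 <- Delta c) (eps c2 *: c1) = c].

Definition is_coalgebra_map C D
    (DeltaC : C -> C ⊗ C) (epsC : C -> k^o)
    (DeltaD : D -> D ⊗ D) (epsD : D -> k^o) (f : C -> D) : Prop :=
  (forall c, DeltaD (f c) = tmap f f (DeltaC c)) /\
  (forall c, epsD (f c) = epsC c).

Definition cop C (Delta : C -> C ⊗ C) (c : C) : C ⊗ C := tswap (Delta c).

Definition tensor_comul C D (DeltaC : C -> C ⊗ C) (DeltaD : D -> D ⊗ D)
    (t : C ⊗ D) : (C ⊗ D) ⊗ (C ⊗ D) :=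
  \sw_(c, d <- t) \sw_(c1, c2 <- DeltaC c) \sw_(d1, d2 <- DeltaD d)
    ((c1 ⊗ d1) ⊗ (c2 ⊗ d2)).

Definition tensor_counit C D (epsC : C -> k^o) (epsD : D -> k^o)
    (t : C ⊗ D) : k^o :=
  \sw_(c, d <- t) (epsC c * epsD d : k^o).

(* Delta4 c = c_1 (x) c_2 (x) c_3 (x) c_4 *)
Definition Delta4 C (Delta : C -> C ⊗ C) (c : C) : C ⊗ C ⊗ C ⊗ C :=
  tmap (tmap Delta idfun) idfun (tmap Delta idfun (Delta c)).

Definition group_like C (Delta : C -> C ⊗ C) (eps : C -> k^o) (g : C) : Prop :=
  Delta g = g ⊗ g /\ eps g = 1.

End Coalgebra.

Section HopfHeap.
Variables (k : fieldType) (C : lmodType k).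
Implicit Types (Delta : {linear C -> (C ⊗ C)%type}) (eps : {linear C -> k^o}).
Implicit Types (br : {linear (C ⊗ C ⊗ C)%type -> C}) (B : {linear C -> C}).

(* The bracket [a, b, c] is br (a ⊗ b ⊗ c).  The last field is the standing
   convention that a Hopf heap has a group-like element. *)
Record is_hopf_heap Delta eps br : Prop := IsHopfHeap {
  heap_coalgebra : is_coalgebra Delta eps;
  heap_bracket_coalgebra_map :
    is_coalgebra_map
      (tensor_comul (tensor_comul Delta (cop Delta)) Delta)
      (tensor_counit (tensor_counit eps eps) eps)
      Delta eps br;
  heap_assoc : forall a b c d h,
    br (br (a ⊗ b ⊗ c) ⊗ d ⊗ h) = br (a ⊗ b ⊗ br (c ⊗ d ⊗ h));
  heap_malcevl : forall a c,
    \sw_(c1, c2 <- Delta c) br (c1 ⊗ c2 ⊗ a) = eps c *: a;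
  heap_malcevr : forall a c,
    \sw_(c1, c2 <- Delta c) br (a ⊗ c1 ⊗ c2) = eps c *: a;
  heap_group_like : exists g, group_like Delta eps g }.

Definition commutative_heap br : Prop :=
  forall x y z, br (x ⊗ y ⊗ z) = br (z ⊗ y ⊗ x).

Definition rota_baxter Delta br B : Prop :=
  (forall a b c, B (br (a ⊗ b ⊗ c)) = br (B a ⊗ B b ⊗ B c)) /\
  (forall a, \sw_(a1, a2 <- Delta a) (B a1 ⊗ B a2) =
     \sw_(b1, b2, b3, b4 <- Delta4 Delta (B a))
       (br (b1 ⊗ B b4 ⊗ B b2) ⊗ b3)).

Definition rb_comul Delta br B (a : C) : C ⊗ C :=
  \sw_(a1, a2, a3, a4 <- Delta4 Delta a) (br (a1 ⊗ B a4 ⊗ B a2) ⊗ a3).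

Lemma rb_comul_linear Delta br B : linear (rb_comul Delta br B).
Proof.
have tl V W := (tens_bilinear V W).1; have tr V W := (tens_bilinear V W).2.
have quad : quadrilinear (fun a1 a2 a3 a4 =>
    tens (br (tens (tens a1 (B a4)) (B a2))) a3).
  split=> [x y z|x y z|x y z|x y z] a u v; rewrite ?linearP.
  - by rewrite tl tl linearP; exact: tl.
  - by rewrite tr linearP; exact: tl.
  - exact: tr.
  - by rewrite tr tl linearP; exact: tl.
move=> a x y; rewrite /rb_comul /Delta4 !linearP; exact: tlift4_linear.
Qed.

HB.instance Definition _ Delta br B :=
  GRing.isLinear.Build k C (C ⊗ C)%type *:%R (rb_comul Delta br B)
    (rb_comul_linear Delta br B).

End HopfHeap.

(* Main.v *)
Require Import Defs.
From HB Require Import structures.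
From mathcomp Require Import all_boot all_order all_algebra.

(* Since B is surjective, the Rota-Baxter identity, read as
   Delta' o B = (B (x) B) o Delta, together with eps o B = eps and
   B o [-,-,-] = [-,-,-] o (B (x) B (x) B), exhibits (C, Delta') as the image
   of the Hopf heap (C, Delta) under a surjection that commutes with all the
   operations, so that every axiom is transported along B. *)

Local Open Scope ring_scope.
Import GRing.Theory.

(** * Linear maps out of tensor products, and functoriality of ⊗ *)

Section TensorLemmas.
Set Implicit Arguments.
Unset Strict Implicit.
Unset Printing Implicit Defensive.
Variable k : fieldType.
Implicit Types U V W : lmodType k.

Lemma eq_tlift V W U (f g : V -> W -> U) : f =2 g -> tlift f =1 tlift g.
Proof. by move=> fg x; apply: eq_bigr => p _; exact: fg. Qed.

(** [tlift f x] is a finite sum over a chosen representative of [x], so additivity of [L]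
    suffices. *)
Lemma linear_tlift V W U U' (L : {linear U -> U'}) (f : V -> W -> U) x :
  L (tlift f x) = tlift (fun v w => L (f v w)) x.
Proof. by rewrite linear_sum. Qed.

(** A form of [tensor_ext] for bare functions such as [fun x => f (x ⊗ v3)], whose linearity is only
    a proposition; they are bundled on the spot. *)
Lemma linear_tens_ext V W U (f g : V ⊗ W -> U) : linear f -> linear g ->
  (forall v w, f (v ⊗ w) = g (v ⊗ w)) -> f =1 g.
Proof.
move=> fl gl.
pose F : {linear (V ⊗ W)%type -> U} := HB.pack f (GRing.isLinear.Build _ _ _ _ f fl).
pose G : {linear (V ⊗ W)%type -> U} := HB.pack g (GRing.isLinear.Build _ _ _ _ g gl).
exact: (@tensor_ext _ _ _ _ F G).
Qed.

Lemma tens_linearl V W (w : W) : linear (fun v : V => v ⊗ w).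
Proof. exact: (tens_bilinear V W).1. Qed.

Lemma tens_linearr V W (v : V) : linear (fun w : W => v ⊗ w).
Proof. exact: (tens_bilinear V W).2. Qed.

Lemma linear_tens_ext3 V1 V2 V3 U (f g : V1 ⊗ V2 ⊗ V3 -> U) :
  linear f -> linear g ->
  (forall v1 v2 v3, f (v1 ⊗ v2 ⊗ v3) = g (v1 ⊗ v2 ⊗ v3)) -> f =1 g.
Proof.
move=> fl gl fg; apply: linear_tens_ext => // x v3.
apply: (linear_tens_ext (f := fun x => f (x ⊗ v3)) (g := fun x => g (x ⊗ v3))).
- by move=> a y z; rewrite tens_linearl fl.
- by move=> a y z; rewrite tens_linearl gl.
- by move=> v1 v2; exact: fg.
Qed.

Lemma tmap_tens V V' W W' (f : {linear V -> V'}) (g : {linear W -> W'}) v w :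
  tmap f g (v ⊗ w) = f v ⊗ g w.
Proof.
by rewrite /tmap tlift_tens//; split=> ? ? ? ?; rewrite linearP ?tens_linearl ?tens_linearr.
Qed.

(** Change of variables in Sweedler sums. The chosen representatives of [t] and [tmap f g t] are
    unrelated, so termwise comparison fails; the proof writes [t] as a sum of pure tensors and
    inducts on its length. *)
Lemma tlift_tmap V V' W W' U (f : {linear V -> V'}) (g : {linear W -> W'})
    (h : V' -> W' -> U) t : Defs.bilinear h ->
  tlift h (tmap f g t) = tlift (fun v w => h (f v) (g w)) t.
Proof.
move=> hb; have [s ->] := tensor_sum t.
have hfg : Defs.bilinear (fun v w => h (f v) (g w)).
  by split=> [w|v] a x y; rewrite linearP; [exact: hb.1|exact: hb.2].
elim: s {t} => [|[v w] s IHs].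
  (* The zero tensor is the class of the empty sequence, so both sides become empty sums. *)
  by rewrite big_nil linear0 !(tlift_pi _ [::]) ?big_nil.
have D (X Y : lmodType k) (e : X -> Y -> U) x y : Defs.bilinear e ->
    tlift e (x + y) = tlift e x + tlift e y.
  by move=> /tlift_linear/(_ 1 x y); rewrite !scale1r.
by rewrite big_cons linearD /= !D// IHs tmap_tens !tlift_tens.
Qed.

Lemma tmap_comp V V' V'' W W' W'' (f : {linear V -> V'}) (f' : {linear V' -> V''})
    (g : {linear W -> W'}) (g' : {linear W' -> W''}) t :
  tmap f' g' (tmap f g t) = tmap (f' \o f) (g' \o g) t.
Proof.
rewrite [LHS]tlift_tmap//.
by split=> ? ? ? ?; rewrite linearP ?tens_linearl ?tens_linearr.
Qed.

Lemma eq_tmap V V' W W' (f f' : V -> V') (g g' : W -> W') :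
  f =1 f' -> g =1 g' -> tmap f g =1 tmap f' g'.
Proof. by move=> ff' gg'; apply: eq_tlift => v w; rewrite ff' gg'. Qed.

(** Lift each factor of each pure tensor, then add the lifts. *)
Lemma tmap_surj V V' W W' (f : {linear V -> V'}) (g : {linear W -> W'}) :
  (forall y, exists x, f x = y) -> (forall y, exists x, g x = y) ->
  forall t, exists s, tmap f g s = t.
Proof.
move=> fS gS t; have [s ->] := tensor_sum t.
elim: s => [|[v w] s [u uE]]; first by exists 0; rewrite big_nil linear0.
have [x xE] := fS v; have [y yE] := gS w.
by exists (x ⊗ y + u); rewrite linearD /= tmap_tens uE big_cons xE yE.
Qed.

(** * Naturality of the associator *)

Lemma tassoc_inner_bilinear V1 V2 V3 (v3 : V3) :
  Defs.bilinear (fun (v1 : V1) (v2 : V2) => v1 ⊗ (v2 ⊗ v3)).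
Proof.
split=> ? ? ? ?; first exact: tens_linearl.
by rewrite tens_linearl tens_linearr.
Qed.

Lemma tassoc_bilinear V1 V2 V3 :
  Defs.bilinear (fun (x : V1 ⊗ V2) (v3 : V3) => \sw_(v1, v2 <- x) (v1 ⊗ (v2 ⊗ v3))).
Proof.
split=> [v3|x a y z]; first exact/tlift_linear/tassoc_inner_bilinear.
by apply: tlift_linearf => v1 v2; rewrite !tens_linearr.
Qed.

(** Needed to carry coassociativity along a coalgebra map. After the changes of variables both sides
    are iterated sums over the same representatives, compared term by term. *)
Lemma tassoc_tmap V1 V2 V3 W1 W2 W3 (f1 : {linear V1 -> W1})
    (f2 : {linear V2 -> W2}) (f3 : {linear V3 -> W3}) t :
  tassoc (tmap (tmap f1 f2) f3 t) = tmap f1 (tmap f2 f3) (tassoc t).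
Proof.
rewrite /tassoc tlift_tmap ?linear_tlift; last exact: tassoc_bilinear.
apply: eq_tlift => x v3.
rewrite tlift_tmap ?linear_tlift; last exact: tassoc_inner_bilinear.
by apply: eq_tlift => v1 v2; do !rewrite /= tmap_tens.
Qed.

(** * Linearity of co-opposite and tensor product coalgebra structures *)

Lemma tswap_bilinear V W : Defs.bilinear (fun (v : V) (w : W) => w ⊗ v).
Proof. by split=> ? ? ? ?; rewrite ?tens_linearl ?tens_linearr. Qed.

Lemma cop_linear V (D : {linear V -> (V ⊗ V)%type}) : linear (cop D).
Proof. by move=> a x y; rewrite /cop linearP; exact/tlift_linear/tswap_bilinear. Qed.

(** Bundling lets [cop D] be a factor of [tensor_comul], as in the domain C ⊗ C^cop ⊗ C of the
    bracket. *)
HB.instance Definition _ V (D : {linear V -> (V ⊗ V)%type}) :=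
  GRing.isLinear.Build k V (V ⊗ V)%type *:%R (cop D) (@cop_linear V D).

Lemma tensor_comul_inner_bilinear V W (c1 c2 : V) :
  Defs.bilinear (fun d1 d2 : W => (c1 ⊗ d1) ⊗ (c2 ⊗ d2)).
Proof. by split=> ? ? ? ?; rewrite tens_linearr ?tens_linearl ?tens_linearr. Qed.

Lemma tensor_comul_outer_bilinear V W (y : W ⊗ W) :
  Defs.bilinear (fun c1 c2 : V => \sw_(d1, d2 <- y) ((c1 ⊗ d1) ⊗ (c2 ⊗ d2))).
Proof.
by split=> ? ? ? ?; apply: tlift_linearf => ? ?;
  rewrite tens_linearl ?tens_linearl ?tens_linearr.
Qed.

Lemma tensor_comul_bilinear V W (DV : {linear V -> (V ⊗ V)%type})
    (DW : {linear W -> (W ⊗ W)%type}) :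
  Defs.bilinear (fun c d => \sw_(c1, c2 <- DV c) \sw_(d1, d2 <- DW d)
    ((c1 ⊗ d1) ⊗ (c2 ⊗ d2))).
Proof.
split=> [d|c] a x y; rewrite linearP.
  exact/tlift_linear/tensor_comul_outer_bilinear.
apply: tlift_linearf => c1 c2.
exact/tlift_linear/tensor_comul_inner_bilinear.
Qed.

Lemma tensor_comul_linear V W (DV : {linear V -> (V ⊗ V)%type})
  (DW : {linear W -> (W ⊗ W)%type}) : linear (tensor_comul DV DW).
Proof. exact/tlift_linear/tensor_comul_bilinear. Qed.

HB.instance Definition _ V W (DV : {linear V -> (V ⊗ V)%type})
    (DW : {linear W -> (W ⊗ W)%type}) :=
  GRing.isLinear.Build k (V ⊗ W)%type ((V ⊗ W) ⊗ (V ⊗ W))%type *:%R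
    (tensor_comul DV DW) (@tensor_comul_linear V W DV DW).

Lemma tensor_counit_bilinear V W (eV : {linear V -> k^o}) (eW : {linear W -> k^o}) :
  Defs.bilinear (fun v w => eV v * eW w : k^o).
Proof.
split=> [w|v] a x y; rewrite linearP; first by rewrite mulrDl -scalerAl.
by rewrite mulrDr -scalerAr.
Qed.

Lemma tensor_counit_linear V W (eV : {linear V -> k^o}) (eW : {linear W -> k^o}) :
  linear (tensor_counit eV eW).
Proof. exact/tlift_linear/tensor_counit_bilinear. Qed.

HB.instance Definition _ V W (eV : {linear V -> k^o}) (eW : {linear W -> k^o}) :=
  GRing.isLinear.Build k (V ⊗ W)%type k^o *:%R
    (tensor_counit eV eW) (@tensor_counit_linear V W eV eW).

End TensorLemmas.

(** * Coalgebra maps and transport of structure along surjections *)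

Section CoalgebraMaps.
Set Implicit Arguments.
Unset Strict Implicit.
Unset Printing Implicit Defensive.
Variable k : fieldType.
Implicit Types C D E : lmodType k.

Lemma is_coalgebra_map_cop C D (DC : {linear C -> (C ⊗ C)%type}) eC
    (DD : {linear D -> (D ⊗ D)%type}) eD (f : {linear C -> D}) :
  is_coalgebra_map DC eC DD eD f ->
  is_coalgebra_map (cop DC) eC (cop DD) eD f.
Proof.
move=> [fD fe]; split=> // c; rewrite /cop fD /tswap linear_tlift.
rewrite tlift_tmap; last exact: tswap_bilinear.
by apply: eq_tlift => v w; rewrite /= tmap_tens.
Qed.

Lemma is_coalgebra_map_tmap C C' D D'
    (DC : {linear C -> (C ⊗ C)%type}) (eC : {linear C -> k^o})
    (DC' : {linear C' -> (C' ⊗ C')%type}) (eC' : {linear C' -> k^o})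
    (DD : {linear D -> (D ⊗ D)%type}) (eD : {linear D -> k^o})
    (DD' : {linear D' -> (D' ⊗ D')%type}) (eD' : {linear D' -> k^o})
    (f : {linear C -> C'}) (g : {linear D -> D'}) :
  is_coalgebra_map DC eC DC' eC' f -> is_coalgebra_map DD eD DD' eD' g ->
  is_coalgebra_map (tensor_comul DC DD) (tensor_counit eC eD)
    (tensor_comul DC' DD') (tensor_counit eC' eD') (tmap f g).
Proof.
move=> [fD fe] [gD ge]; split=> t; last first.
  rewrite /tensor_counit tlift_tmap; last exact: tensor_counit_bilinear.
  by apply: eq_tlift => c d; rewrite fe ge.
(* Three changes of variables follow: over [t] itself, then over the coproducts of [c] and of
   [d]. *)
rewrite /tensor_comul tlift_tmap ?linear_tlift; last exact: tensor_comul_bilinear.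
apply: eq_tlift => c d; rewrite fD gD.
rewrite tlift_tmap ?linear_tlift; last exact: tensor_comul_outer_bilinear.
apply: eq_tlift => c1 c2.
rewrite tlift_tmap ?linear_tlift; last exact: tensor_comul_inner_bilinear.
by apply: eq_tlift => d1 d2; do !rewrite /= tmap_tens.
Qed.

Lemma is_coalgebra_map_comp C D E DC eC DD eD DE eE
    (f : {linear C -> D}) (g : {linear D -> E}) :
  is_coalgebra_map DC eC DD eD f -> is_coalgebra_map DD eD DE eE g ->
  is_coalgebra_map DC eC DE eE (g \o f).
Proof.
move=> [fD fe] [gD ge]; split=> c /=; last by rewrite ge fe.
by rewrite gD fD tmap_comp.
Qed.

(** Every element of [D] is some [f c], where the conditions on [g] are those on [g \o f] at [c].
    This is how the bracket of the image is shown to be a coalgebra map. *)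
Lemma is_coalgebra_map_cancelr C D E DC eC DD eD DE eE
    (f : {linear C -> D}) (g : {linear D -> E}) :
  (forall y, exists x, f x = y) -> is_coalgebra_map DC eC DD eD f ->
  is_coalgebra_map DC eC DE eE (g \o f) -> is_coalgebra_map DD eD DE eE g.
Proof.
move=> fS [fD fe] [gfD gfe]; split=> d; have [c <-] := fS d.
  by rewrite fD tmap_comp; exact: gfD.
by rewrite fe; exact: gfe.
Qed.

(** At [d = f c], both sides of each law in [D] are images, under [f] or its tensor powers, of the
    two sides of the law in [C] at [c]. *)
Lemma is_coalgebra_surj C D
    (DC : {linear C -> (C ⊗ C)%type}) (eC : {linear C -> k^o})
    (DD : {linear D -> (D ⊗ D)%type}) (eD : {linear D -> k^o})
    (f : {linear C -> D}) :
  (forall y, exists x, f x = y) -> is_coalgebra_map DC eC DD eD f ->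
  is_coalgebra DC eC -> is_coalgebra DD eD.
Proof.
move=> fS [fD fe] [coassoc counitl counitr].
split=> d; have [c <-] := fS d; rewrite !fD.
- rewrite !tmap_comp.
  (* Replacing [DD \o f] by [tmap f f \o DC] moves all copies of [f] outside, so that [tassoc_tmap]
     exposes the coassociativity of [DC]. *)
  rewrite (eq_tmap (f' := tmap f f \o DC) (g' := f \o idfun) fD)//.
  rewrite -(tmap_comp DC (tmap f f) idfun f).
  rewrite tassoc_tmap coassoc tmap_comp.
  by apply: eq_tmap => // x; rewrite /= fD.
- rewrite tlift_tmap; last first.
    split=> [w|v] a x y; last by rewrite linearP.
    by rewrite linearP scalerDl -scalerA.
  rewrite -[in RHS](counitl c) linear_tlift.
  by apply: eq_tlift => v w; rewrite fe linearZ.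
- rewrite tlift_tmap; last first.
    split=> [w|v] a x y; first by rewrite linearP.
    by rewrite linearP scalerDl -scalerA.
  rewrite -[in RHS](counitr c) linear_tlift.
  by apply: eq_tlift => v w; rewrite fe linearZ.
Qed.

(** Since [f] is onto and respects coproduct, counit and bracket, each axiom in [D] is the image
    under [f] of the same axiom in [C]. *)
Lemma is_hopf_heap_surj C D
    (DC : {linear C -> (C ⊗ C)%type}) (eC : {linear C -> k^o})
    (brC : {linear (C ⊗ C ⊗ C)%type -> C})
    (DD : {linear D -> (D ⊗ D)%type}) (eD : {linear D -> k^o})
    (brD : {linear (D ⊗ D ⊗ D)%type -> D})
    (f : {linear C -> D}) :
  (forall y, exists x, f x = y) -> is_coalgebra_map DC eC DD eD f ->
  (forall a b c, f (brC (a ⊗ b ⊗ c)) = brD (f a ⊗ f b ⊗ f c)) ->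
  is_hopf_heap DC eC brC -> is_hopf_heap DD eD brD.
Proof.
move=> fS fcoalg fbr [coalg brcoalg assoc malcevl malcevr [g [gD ge]]].
have [fD fe] := fcoalg.
(* Compatibility with brackets passes from pure tensors to all tensors. *)
have brT t : brD (tmap (tmap f f) f t) = f (brC t).
  apply: (linear_tens_ext3 (f := brD \o tmap (tmap f f) f) (g := f \o brC)).
  - exact: linearP.
  - exact: linearP.
  by move=> a b c /=; do !rewrite /= tmap_tens; rewrite fbr.
split.
- exact: is_coalgebra_surj fS fcoalg coalg.
(* Cancel the surjection f ⊗ f ⊗ f: by [brT], [brD] after it equals [f \o brC], a composite of
   coalgebra maps. *)
- apply: (is_coalgebra_map_cancelr (f := tmap (tmap f f) f)).
  + exact/tmap_surj/fS/tmap_surj.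
  + apply/is_coalgebra_map_tmap/fcoalg/is_coalgebra_map_tmap => //.
    exact: is_coalgebra_map_cop.
  + have [Dfbr efbr] := is_coalgebra_map_comp brcoalg fcoalg.
    split=> t; rewrite /= brT.
      by rewrite [LHS]Dfbr; apply: eq_tmap => x /=; rewrite brT.
    exact: efbr.
- move=> a b c d h; have [a' <-] := fS a; have [b' <-] := fS b.
  have [c' <-] := fS c; have [d' <-] := fS d; have [h' <-] := fS h.
  by rewrite -!fbr assoc.
- move=> a c; have [a' <-] := fS a; have [c' <-] := fS c.
  rewrite fD tlift_tmap; last first.
    by split=> ? ? ? ?; rewrite !(tens_linearl, tens_linearr) linearP.
  rewrite fe -linearZ -malcevl linear_tlift.
  by apply: eq_tlift => v w; rewrite fbr.
- move=> a c; have [a' <-] := fS a; have [c' <-] := fS c.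
  rewrite fD tlift_tmap; last first.
    by split=> ? ? ? ?; rewrite !(tens_linearl, tens_linearr) linearP.
  rewrite fe -linearZ -malcevr linear_tlift.
  by apply: eq_tlift => v w; rewrite fbr.
(* A coalgebra map sends group-likes to group-likes. *)
- by exists (f g); split; rewrite ?fe// fD gD tmap_tens.
Qed.

End CoalgebraMaps.

Theorem theorem5p10 (k : fieldType) (C : lmodType k)
    (Delta : {linear C -> (C ⊗ C)%type}) (eps : {linear C -> k^o})
    (br : {linear (C ⊗ C ⊗ C)%type -> C}) (B : {linear C -> C})
    (C_hopf_heap : is_hopf_heap Delta eps br)
    (C_commutative : commutative_heap br)
    (B_rota_baxter : rota_baxter Delta br B)
    (B_surjective : forall y : C, exists x : C, B x = y)
    (eps_B : forall a : C, eps (B a) = eps a) :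
  is_hopf_heap (rb_comul Delta br B) eps br.
Proof.
have [Bbr BD] := B_rota_baxter.
apply: is_hopf_heap_surj B_surjective _ Bbr C_hopf_heap.
(* By unfolding, the sides of [BD a] are [tmap B B (Delta a)] and [rb_comul Delta br B (B a)]. *)
by split=> // a; exact: esym (BD a).
Qed.
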